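(* For every $d\ge1$, every symmetric positive definite $H\in\mathbb{R}^{d\times d}$ with largest eigenvalue $\lambda_{\max}$ and smallest eigenvalue $\lambda_{\min}$, and every mini-batch size $B\ge1$, the optimal heavy-ball spectral radius satisfies $$s^*(H,B)\ \ge\ 1-8\,\min\left\{\frac{B\,\lambda_{\min}}{\mathrm{Tr}(H)},\ \sqrt{\frac{\lambda_{\min}}{\lambda_{\max}}}\right\}.$$
   Context: Let $H\in\mathbb{R}^{d\times d}$ be symmetric positive definite with eigenvalues $\lambda_{\max}=\lambda_1\ge\dots\ge\lambda_d=\lambda_{\min}>0$ and let $\Lambda=\mathrm{diag}(\lambda_1,\dots,\lambda_d)$. For a step size $\eta>0$, a momentum parameter $\beta\in[0,1)$ and a batch size $B\ge1$, define the $2d\times 2d$ matrix (in $d\times d$ blocks) $$A=\begin{bmatrix}(1+\beta)I-\eta(1-\beta)\Lambda & -\beta I\\ I & 0\end{bmatrix}.$$ The heavy-ball (HB) covariance operator $\mathcal{T}_{H,\eta,\beta,B}$ is the linear map on the space of real symmetric $2d\times 2d$ matrices given by $$\mathcal{T}_{H,\eta,\beta,B}(S)=A\,S\,A^\top+\eta^2(1-\beta)^2\begin{bmatrix}\tfrac1B\,\mathrm{Tr}(\Lambda S^{11})\,\Lambda & 0\\ 0&0\end{bmatrix},$$ where $S^{11}$ is the upper-left $d\times d$ block of $S$. Let $s(H,\eta,\beta,B)=\rho(\mathcal{T}_{H,\eta,\beta,B})$ be its spectral radius (the maximal modulus of its complex eigenvalues), and $$s^*(H,B)=\inf_{\eta>0,\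 \beta\in[0,1)}s(H,\eta,\beta,B).$$ *)

(* Defs.v *)
From HB Require Import structures.
From mathcomp Require Import all_boot all_order all_algebra.
From mathcomp Require Import complex.
From mathcomp Require Import boolp classical_sets reals.

Set Implicit Arguments.
Unset Strict Implicit.
Unset Printing Implicit Defensive.

Import Order.TTheory GRing.Theory Num.Theory.
Import passmx.
Local Open Scope ring_scope.
Local Open Scope classical_set_scope.

Section SymmetricEigenvalues.
Variables (R : realType) (d : nat).
Implicit Type H : 'M[R]_d.

Definition symposdef H :=
  H^T = H /\ forall x : 'cV[R]_d, x != 0 -> 0 < (x^T *m H *m x) 0 0.

(* The eigenvalues counted with multiplicity, in nonincreasing order;
   eigvalsP and eigvals_unique show that this determines the sequence. *)
Definition eigvals H : seq R :=
  xget [::] [set s : seq R | sorted >=%R s /\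
                             char_poly H = \prod_(x <- s) ('X - x%:P)].

Definition lambda_max H : R := head 0 (eigvals H).
Definition lambda_min H : R := last 0 (eigvals H).

Lemma eigvals_unique (s t : seq R) :
  sorted >=%R s -> sorted >=%R t ->
  \prod_(x <- s) ('X - x%:P) = \prod_(x <- t) ('X - x%:P) -> s = t.
Proof.
move=> ss st /prod_XsubC_eq est; apply: (@sorted_eq _ >=%R) => //.
- exact: ge_trans.
- exact: ge_anti.
Qed.

Lemma char_poly_conj (F : fieldType) (P A : 'M[F]_d) : P \in unitmx ->
  char_poly (invmx P *m A *m P) = char_poly A.
Proof.
move=> Pu; rewrite /char_poly /char_poly_mx.
have QP : map_mx polyC (invmx P) *m map_mx polyC P = 1%:M.
  by rewrite -map_mxM mulVmx // map_mx1.
have -> : 'X%:M - map_mx polyC (invmx P *m A *m P) =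
    map_mx polyC (invmx P) *m ('X%:M - map_mx polyC A) *m map_mx polyC P.
  rewrite mulmxBr mulmxBl !map_mxM scalar_mxC -['X%:M *m _ *m _]mulmxA QP.
  by rewrite mulmx1.
by rewrite !det_mulmx mulrAC -det_mulmx QP det1 mul1r.
Qed.

Lemma eigvalsP H : H^T = H ->
  sorted >=%R (eigvals H) /\
  char_poly H = \prod_(x <- eigvals H) ('X - x%:P).
Proof.
move=> Hsym; rewrite /eigvals; case: xgetP => [s _ []|] //.
pose HC := map_mx (real_complex R) H.
have HCherm : HC \is hermsymmx.
  apply/is_hermitianmxP; rewrite expr0 scale1r.
  apply/matrixP => i j; rewrite !mxE -{1}Hsym mxE.
  by rewrite (CrealP _) //; apply/complex_realP; exists (H j i).
have /mxOverP Dreal := hermitian_spectral_diag_real HCherm.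
have /hermitian_normalmx/orthomx_spectralP eqHC := HCherm.
pose D : 'rV[R]_d := map_mx (@complex.Re R) (spectral_diag HC).
have DE : spectral_diag HC = map_mx (real_complex R) D.
  by apply/rowP => j; rewrite !mxE RRe_real.
have cpE : char_poly H = \prod_(j < d) ('X - (D 0 j)%:P).
  apply: (map_poly_inj (real_complex R)); rewrite map_char_poly -/HC.
  rewrite eqHC char_poly_conj ?spectral_unit //.
  rewrite char_poly_trig ?diag_mx_is_trig // rmorph_prod /=.
  apply: eq_bigr => j _.
  by rewrite mxE eqxx mulr1n rmorphB /= map_polyX map_polyC DE mxE.
move=> /(_ (sort >=%R [seq D 0 j | j <- enum 'I_d])) []; split.
  by apply: sort_sorted => x y; rewrite /= le_total.
by rewrite cpE (perm_big _ (permEl (perm_sort _ _))) big_map big_enum.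
Qed.

Lemma size_eigvals H : H^T = H -> size (eigvals H) = d.
Proof.
move=> /eigvalsP[_ /(congr1 (size \o val))] /=.
by rewrite size_char_poly size_prod_XsubC => -[].
Qed.

End SymmetricEigenvalues.

Section SpectralRadius.
Variables (R : realType) (V : vectType R).
Implicit Type f : 'End(V).

(* The complex eigenvalues of a real endomorphism are those of its matrix
   read over the complex numbers; the choice of basis is irrelevant. *)
Definition cspectrum f : set R[i] :=
  let M := mxof (vbasis {:V}) (vbasis {:V}) f in
  [set z | eigenvalue (map_mx (real_complex R) M) z].

(* The supremum is a maximum, see spectral_radius_max. *)
Definition spectral_radius f : R :=
  sup [set ComplexField.Normc.normc z | z in cspectrum f].

Lemma spectral_radius_max f : (0 < \dim {:V})%N ->
  (exists2 z, cspectrum f z & spectral_radius f = ComplexField.Normc.normc z) /\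
  (forall z, cspectrum f z -> ComplexField.Normc.normc z <= spectral_radius f).
Proof.
move=> V0; rewrite /spectral_radius.
set N := [set _ | _ in _].
pose P := map_mx (real_complex R) (mxof (vbasis {:V}) (vbasis {:V}) f).
have [rs rsE] := closed_field_poly_normal (char_poly P).
have memP z : cspectrum f z <-> z \in rs.
  rewrite /cspectrum /= eigenvalue_root_char -/P rsE.
  by rewrite (monicP (char_poly_monic _)) scale1r root_prod_XsubC.
have [z0 z0P] : exists z, cspectrum f z.
  by have [z zP] := eigenvalue_closed P V0; exists z.
have rs0 : (0 < size rs)%N by move/memP: z0P; case: (rs).
pose i0 : 'I_(size rs) := Ordinal rs0.
pose g (i : 'I_(size rs)) : R := ComplexField.Normc.normc (rs`_i).
have [i _ iP] := @arg_maxP _ _ _ i0 xpredT g isT.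
have gP z : cspectrum f z -> ComplexField.Normc.normc z <= g i.
  move/memP => zrs; have zi : (index z rs < size rs)%N by rewrite index_mem.
  by have := iP (Ordinal zi) isT; rewrite /g /= nth_index.
have ci : cspectrum f rs`_i by apply/memP; rewrite mem_nth.
have supN : sup N = g i.
  apply/le_anti/andP; split.
    apply: ge_sup; first by exists (g i), rs`_i.
    by move=> _ [z /gP ? <-].
  apply: ub_le_sup; last by exists rs`_i.
  by exists (g i) => _ [z /gP ? <-].
by split; [exists rs`_i | move=> z; rewrite supN; apply: gP].
Qed.

End SpectralRadius.

Section HeavyBall.
Variables (R : realType) (d : nat).
Variables (H : 'M[R]_d) (eta beta : R) (B : nat).

Definition Lambda : 'M[R]_d := diag_mx (\row_i (eigvals H)`_i).

Definition hb_matrix : 'M[R]_(d + d) :=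
  block_mx ((1 + beta)%:M - (eta * (1 - beta)) *: Lambda) (- beta%:M)
           1%:M                                           0.

Definition hb_cov (S : 'M[R]_(d + d)) : 'M[R]_(d + d) :=
  hb_matrix *m S *m hb_matrix^T +
  (eta ^+ 2 * (1 - beta) ^+ 2) *:
    block_mx ((B%:R^-1 * \tr (Lambda *m ulsubmx S)) *: Lambda) 0 0 0.

End HeavyBall.

Section SymmetricMatrices.
Variables (R : realType) (n : nat).

Definition asym (S : 'M[R]_n) : 'M[R]_n := S - S^T.

Lemma asym_linear : linear asym.
Proof.
by move=> a S T; rewrite /asym raddfD /= linearZ /= opprD addrACA scalerBr.
Qed.
HB.instance Definition _ :=
  GRing.isSemilinear.Build R _ _ _ asym (GRing.semilinear_linear asym_linear).

Definition symspace : {vspace 'M[R]_n} := lker (linfun asym).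

Lemma mem_symspace (S : 'M[R]_n) : (S \in symspace) = (S^T == S).
Proof. by rewrite memv_ker lfunE /= subr_eq0 eq_sym. Qed.

End SymmetricMatrices.

Notation symmx R n := (subvs_of (@symspace R n)).

Section HeavyBallOperator.
Variables (R : realType) (d : nat) (H : 'M[R]_d).
Implicit Types (eta beta : R) (B : nat).

Lemma hb_cov_linear eta beta B : linear (hb_cov H eta beta B).
Proof.
move=> a S T; rewrite /hb_cov mulmxDr mulmxDl -scalemxAr -scalemxAl.
rewrite scalerDr addrACA; congr (_ + _).
set c := eta ^+ 2 * _; rewrite scalerA (mulrC a c) -(scalerA c) -scalerDr; congr (_ *: _).
rewrite scale_block_mx add_block_mx !scaler0 !addr0; congr block_mx.
rewrite scalerA -scalerDl; congr (_ *: _).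
have -> : ulsubmx (a *: S + T) = a *: ulsubmx S + ulsubmx T.
  by apply/matrixP => i j; rewrite !mxE.
by rewrite mulmxDr -scalemxAr mxtraceD mxtraceZ mulrDr mulrCA.
Qed.

Lemma hb_cov_sym eta beta B S : S^T = S ->
  (hb_cov H eta beta B S)^T = hb_cov H eta beta B S.
Proof.
move=> Ssym; rewrite /hb_cov linearD linearZ /= !trmx_mul trmxK Ssym mulmxA.
by rewrite tr_block_mx !trmx0 linearZ /= tr_diag_mx.
Qed.

Definition hb_sym eta beta B (S : symmx R (d + d)) : symmx R (d + d) :=
  vsproj (symspace R (d + d)) (hb_cov H eta beta B (vsval S)).

Lemma hb_sym_linear eta beta B : linear (hb_sym eta beta B).
Proof. by move=> a S T; rewrite /hb_sym linearP hb_cov_linear linearP. Qed.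
HB.instance Definition _ eta beta B :=
  GRing.isSemilinear.Build R _ _ _ (hb_sym eta beta B)
    (GRing.semilinear_linear (hb_sym_linear eta beta B)).

Definition hb_op eta beta B : 'End(symmx R (d + d)) :=
  linfun (hb_sym eta beta B).

(* The projection and linfun lose nothing: hb_op is exactly the restriction
   of hb_cov to the symmetric matrices. *)
Lemma hb_opE eta beta B S :
  vsval (hb_op eta beta B S) = hb_cov H eta beta B (vsval S).
Proof.
rewrite lfunE /= vsprojK // mem_symspace hb_cov_sym //.
by apply/eqP; rewrite -mem_symspace subvsP.
Qed.

Definition hb_rate eta beta B : R := spectral_radius (hb_op eta beta B).

Definition hb_opt_rate B : R :=
  inf [set hb_rate x.1 x.2 B | x in
        [set x : R * R | 0 < x.1 /\ 0 <= x.2 < 1]].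

End HeavyBallOperator.

(* Main.v *)
(** Fix [eta], [beta] and put [a = eta (1 - beta)], [t_i = 1 + beta - a l_i]. On
    matrices with diagonal d x d blocks the operator is a rank-one perturbation
    of a direct sum of 3 x 3 maps, so [z] is an eigenvalue as soon as
    [F z = (a^2 / B) sum_i l_i^2 phi_i(z) = 1], where
    [phi_i(z) = z (z + beta) / ((z - beta) ((z + beta)^2 - z t_i^2))] is the
    upper-left entry of the resolvent of the i-th map at the first unit matrix.
    [F] blows up to the right of its largest pole and tends to 0 at infinity,
    hence the rate is at least every pole, and at least every [c] to the right
    of the poles with [F c >= 1]. If [0 < c = 1 - 8 min] were to the right of
    all poles, positivity of the denominators for the extreme eigenvalues would
    force [1 - c < 4 sqrt (l_min / l_max)], and, when the minimum is
    [B l_min / Tr H], also [F c >= 1]. *)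
Require Import Defs.
From mathcomp Require Import all_boot all_order all_algebra.
From mathcomp Require Import reals.
From mathcomp Require Import complex ring lra.

Set Implicit Arguments.
Unset Strict Implicit.
Unset Printing Implicit Defensive.

Import Order.TTheory GRing.Theory Num.Theory.
Local Open Scope ring_scope.

(** * Poles and roots of the secular equation *)

Section SecularEquation.
Variable R : rcfType.
Implicit Types b c t w z : R.

(* [hb_den b t z = 0] iff [z] is the square of a root of [X^2 - t X + b]. *)
Definition hb_den b t z : R := (z + b) ^+ 2 - z * t ^+ 2.

Definition hb_resolvent b t z : R := z * (z + b) / ((z - b) * hb_den b t z).

(** Cross-multiplying cancels [t]: [w * hb_den b t z - z * hb_den b t w] equals
    [(z - w) * (w * z - b ^+ 2)]. *)
Lemma hb_den_gt0_le b t w z :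
  0 <= b -> b < w -> w <= z -> 0 < hb_den b t w -> 0 < hb_den b t z.
Proof.
move=> b0 bw wz Dw.
have w0 : 0 < w by apply: le_lt_trans bw.
rewrite -(pmulr_rgt0 _ w0).
have -> : w * hb_den b t z =
    z * hb_den b t w + (z - w) * (w * (z - w) + (w - b) * (w + b)).
  by rewrite /hb_den; ring.
apply: ltr_wpDr; last by rewrite mulr_gt0 // (lt_le_trans w0).
by apply: mulr_ge0; [lra|apply: addr_ge0; apply: mulr_ge0; lra].
Qed.

Lemma hb_resolvent_gt0 b t z :
  0 <= b -> b < z -> 0 < hb_den b t z -> 0 < hb_resolvent b t z.
Proof.
move=> b0 bz Dz; have z0 : 0 < z by apply: le_lt_trans bz.
by apply: divr_gt0; apply: mulr_gt0 => //; lra.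
Qed.

(* For [t ^+ 2 < 4 * b] the two roots of [X^2 - t X + b] are complex conjugate
   of modulus [sqrt b]; there [Num.sqrt] of a negative number is 0 and the
   maximum is [b]. *)
Definition hb_pole b t : R :=
  Num.max b (((`|t| + Num.sqrt (t ^+ 2 - 4 * b)) / 2) ^+ 2).

(** Real roots of [X^2 - t X + b] factor [hb_den] through their squares; otherwise it is
    [(z - b) ^+ 2 + z * (4 * b - t ^+ 2)]. *)
Lemma hb_den_gt0 b t z : 0 <= b -> hb_pole b t < z -> 0 < hb_den b t z.
Proof.
move=> b0; rewrite /hb_pole gt_max => /andP[bz].
have z0 : 0 < z by apply: le_lt_trans bz.
have tE : t ^+ 2 = `|t| ^+ 2 by rewrite real_normK ?num_real.
rewrite /hb_den.
have [D0|D0] := lerP 0 (t ^+ 2 - 4 * b).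
  have := sqr_sqrtr D0; have := sqrtr_ge0 (t ^+ 2 - 4 * b).
  rewrite tE; have := normr_ge0 t.
  move: (`|t|) (Num.sqrt _) => u s u0 s0 sE uz.
  have -> : (z + b) ^+ 2 - z * u ^+ 2 =
      (z - ((u + s) / 2) ^+ 2) * (z - ((u - s) / 2) ^+ 2).
    have -> : b = (u ^+ 2 - s ^+ 2) / 4 by rewrite sE; field.
    by field.
  rewrite mulr_gt0 ?subr_gt0 //; apply: le_lt_trans uz.
  by nra.
move=> _; have := sqr_ge0 (z - b); nra.
Qed.

Lemma hb_pole_root b t :
  0 <= b -> (hb_pole b t - b) * hb_den b t (hb_pole b t) = 0.
Proof.
move=> b0; rewrite {1}/hb_pole; case: (leP b _); last by rewrite subrr mul0r.
set q := (_ ^+ 2) => bq; have -> : hb_pole b t = q by apply/max_idPr.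
have [D0|D0] := lerP 0 (t ^+ 2 - 4 * b).
  rewrite (_ : hb_den b t q = 0) ?mulr0 // /hb_den /q.
  have tE : t ^+ 2 = `|t| ^+ 2 by rewrite real_normK ?num_real.
  have := sqr_sqrtr D0; rewrite tE; move: (`|t|) (Num.sqrt _) => u s sE.
  have -> : b = (u ^+ 2 - s ^+ 2) / 4 by rewrite sE; field.
  by field.
(* Here [q = t ^+ 2 / 4 < b], against [bq]. *)
move: bq; rewrite /q ltr0_sqrtr // addr0 expr_div_n real_normK ?num_real //.
move=> bq.
nra.
Qed.

Section Sum.
Variables (I : finType) (g t : I -> R) (b : R).

Definition hb_secular z : R := \sum_i g i * hb_resolvent b (t i) z.

Let den_poly i : {poly R} := ('X + b%:P) ^+ 2 - 'X * (t i ^+ 2)%:P.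

(** Clearing denominators in [1 - hb_secular] makes the intermediate value theorem for polynomials
    over a real closed field available. *)
Let secular_poly : {poly R} :=
  ('X - b%:P) * \prod_i den_poly i -
  \sum_i (g i)%:P * ('X * ('X + b%:P)) * \prod_(j | j != i) den_poly j.

Let horner_den_poly i z : (den_poly i).[z] = hb_den b (t i) z.
Proof. by rewrite /den_poly /hb_den !hornerE. Qed.

Let horner_secular_poly z : 0 <= b -> b < z ->
    (forall i, 0 < hb_den b (t i) z) ->
  secular_poly.[z] =
  (z - b) * (\prod_i hb_den b (t i) z) * (1 - hb_secular z).
Proof.
move=> b0 bz D0; rewrite /secular_poly !hornerE horner_prod horner_sum.
rewrite mulrBr mulr1.
rewrite (eq_bigr _ (fun i _ => horner_den_poly i z)).
congr (_ - _); rewrite /hb_secular mulr_sumr; apply: eq_bigr => i _.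
rewrite !hornerE horner_prod (eq_bigr _ (fun i _ => horner_den_poly i z)).
rewrite [in RHS](bigD1 i) //= /hb_resolvent.
have := D0 i; move: (hb_den _ _ _) (\prod_(_ | _) _) => D P Dgt0.
by field; rewrite subr_eq0 !gt_eqF.
Qed.

Lemma hb_secular_eventually_le1 w : 0 <= b -> (forall i, 0 < g i) ->
  exists2 z, w <= z & hb_secular z <= 1.
Proof.
move=> b0 g0.
pose N : R := \sum_i g i.
have N0 : 0 <= N by apply: sumr_ge0 => i _; exact: ltW.
pose T : R := \sum_i t i ^+ 2.
have T0 : 0 <= T by apply: sumr_ge0 => i _; exact: sqr_ge0.
(* The bound with [2 * N] makes [hb_den] at least [(z + b) * (2 * N)], [2 * b < z] gives
   [z <= 2 * (z - b)], and [1 + T <= z] keeps [hb_den] positive even for [N = 0]. *)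
have [z [wz zb zN zT]] :
    exists z, [/\ w <= z, 2 * b < z, 2 * N + T <= z & 1 + T <= z].
  have [v v0 wv] : exists2 v : R, 0 <= v & w <= v.
    by exists `|w|; rewrite ?normr_ge0 ?ler_norm.
  move: (T) (N) T0 N0 => x y x0 y0.
  by exists (v + 2 * b + x + 2 * y + 1); split; lra.
exists z => //.
have resp i : hb_resolvent b (t i) z * N <= 1.
  have tT : t i ^+ 2 <= T.
    by rewrite /T (bigD1 i) //= lerDl sumr_ge0 // => j _; exact: sqr_ge0.
  have zt : 2 * N <= z - t i ^+ 2 by lra.
  have D1 : (z + b) * (2 * N) <= hb_den b (t i) z.
    apply: le_trans (_ : (z + b) * (z - t i ^+ 2) <= _).
      by apply: ler_wpM2l => //; lra.
    rewrite /hb_den; have := sqr_ge0 (t i).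
    move: (t i ^+ 2) => s s0; nra.
  have D0 : 0 < hb_den b (t i) z.
    rewrite /hb_den; have : t i ^+ 2 + 1 <= z by lra.
    move: (t i ^+ 2) => s; nra.
  have zb0 : 0 < z - b by lra.
  rewrite /hb_resolvent mulrAC ler_pdivrMr ?mulr_gt0 // mul1r.
  apply: le_trans (_ : (z - b) * ((z + b) * (2 * N)) <= _).
    rewrite -subr_ge0.
    rewrite (_ : _ - _ = (z + b) * N * (z - 2 * b)); last by ring.
    by rewrite !mulr_ge0 //; lra.
  by rewrite ler_pM2l.
have [N00|Nn0] := eqVneq N 0.
  rewrite /hb_secular big1 // => i _.
  have := @psumr_eq0P _ I predT g (fun i _ => ltW (g0 i)) N00 i isT.
  by move=> ->; rewrite mul0r.
have Np : 0 < N by rewrite lt_neqAle eq_sym Nn0.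
apply: le_trans (_ : \sum_i g i * N^-1 <= _).
  apply: ler_sum => i _; rewrite ler_pM2l //.
  by rewrite -[N^-1]mul1r ler_pdivlMr.
by rewrite -mulr_suml -/N divff.
Qed.

(** Right of [w] all denominators stay positive, so [secular_poly] has the sign of [1 - hb_secular],
    which changes by the time [z] is large. *)
Lemma hb_secular_root w : 0 <= b -> (forall i, 0 < g i) ->
  b < w -> (forall i, 0 < hb_den b (t i) w) -> 1 <= hb_secular w ->
  exists z, [/\ w <= z, forall i, 0 < hb_den b (t i) z & hb_secular z = 1].
Proof.
move=> b0 g0 bw Dw Fw.
have D0 i z : w <= z -> 0 < hb_den b (t i) z.
  by move=> wz; apply: hb_den_gt0_le wz (Dw i).
have Q0 z : w <= z -> 0 < (z - b) * \prod_i hb_den b (t i) z.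
  move=> wz; rewrite mulr_gt0 ?subr_gt0 ?(lt_le_trans bw) //.
  by rewrite prodr_gt0 // => i _; exact: D0.
have GE z : w <= z -> secular_poly.[z] =
    (z - b) * (\prod_i hb_den b (t i) z) * (1 - hb_secular z).
  move=> wz; apply: horner_secular_poly => //; first exact: lt_le_trans wz.
  by move=> i; exact: D0.
have [M wM FM] := hb_secular_eventually_le1 w b0 g0.
have [||z /andP[wz _] /rootP Gz] := @poly_ivt R secular_poly w M => //.
  rewrite !GE // (pmulr_rle0 _ (Q0 _ _)) // (pmulr_rge0 _ (Q0 _ _)) //.
  by rewrite subr_le0 Fw subr_ge0.
exists z; split=> // [i|]; first exact: D0.
apply/esym/eqP; rewrite -subr_eq0.
by move/eqP: Gz; rewrite GE // mulf_eq0 gt_eqF ?Q0.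
Qed.

Lemma hb_secular_root_above_pole i0 : 0 <= b -> (forall i, 0 < g i) ->
  0 < hb_pole b (t i0) ->
  (forall i, hb_pole b (t i) <= hb_pole b (t i0)) ->
  exists z, [/\ hb_pole b (t i0) <= z, b < z,
    forall i, 0 < hb_den b (t i) z & hb_secular z = 1].
Proof.
set z0 := hb_pole _ _ => b0 g0 z0_gt0 z0_max.
(* Where the denominator is positive, [0 <= q.[z]] says that the [i0] term alone is at least 1. At
   the pole only the positive part of [q] survives. *)
pose q : {poly R} :=
  (g i0)%:P * ('X * ('X + b%:P)) - ('X - b%:P) * den_poly i0.
have qE z : q.[z] = g i0 * (z * (z + b)) - (z - b) * hb_den b (t i0) z.
  by rewrite /q /den_poly /hb_den !hornerE.
have qz0 : 0 < q.[z0].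
  by rewrite qE hb_pole_root // subr0 !mulr_gt0 //; lra.
have [w z0w qw] : exists2 w, z0 < w & 0 <= q.[w].
  have [q1|q1] := lerP 0 q.[z0 + 1]; first by exists (z0 + 1); rewrite ?ltrDl.
  have [|| w /andP[z0w _]] := @poly_ivt R (- q) z0 (z0 + 1).
  - by rewrite lerDl.
  - by rewrite !hornerN oppr_le0 oppr_ge0 !ltW.
  rewrite rootN => /rootP qw; exists w; rewrite ?qw // lt_neqAle z0w andbT.
  by apply/negP => /eqP zw; rewrite zw qw ltxx in qz0.
have bz0 : b <= z0 by rewrite le_max lexx.
have bw : b < w by apply: le_lt_trans z0w.
have D0 i : 0 < hb_den b (t i) w.
  by apply: hb_den_gt0 => //; apply: le_lt_trans z0w.
have Fw : 1 <= hb_secular w.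
  rewrite /hb_secular (bigD1 i0) //= ler_wpDr //.
    apply: sumr_ge0 => i _; rewrite mulr_ge0 ?ltW //.
    exact: hb_resolvent_gt0.
  have den0 : 0 < (w - b) * hb_den b (t i0) w.
    by apply: mulr_gt0; rewrite // subr_gt0.
  rewrite /hb_resolvent mulrA ler_pdivlMr // mul1r.
  by move: qw; rewrite qE subr_ge0.
have [z [wz Dz Fz]] := hb_secular_root b0 g0 bw D0 Fw.
exists z; split=> //; first exact: le_trans (ltW z0w) wz.
exact: lt_le_trans wz.
Qed.

End Sum.

End SecularEquation.

(** * Real eigenvalues: spectral radius, positivity and trace *)

Section RealEigenvalues.
Import passmx.
Variable R : realType.

Lemma spectral_radius_ge0 (V : vectType R) (f : 'End(V)) :
  (0 < \dim {:V})%N -> 0 <= spectral_radius f.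
Proof.
move=> /(spectral_radius_max f)[[z _ ->] _].
by case: z => x y /=; exact: sqrtr_ge0.
Qed.

Lemma eigenvalue_le_spectral_radius (V : vectType R) (f : 'End(V)) v z :
  v != 0 -> f v = z *: v -> z <= spectral_radius f.
Proof.
move=> v0 fv.
have V0 : (0 < \dim {:V})%N.
  rewrite lt0n dimv_eq0; apply: contraNneq v0 => V0.
  by rewrite -memv0 -V0 memvf.
have [_ /(_ (real_complex R z))] := spectral_radius_max f V0.
have be : basis_of {:V} (vbasis {:V}) := vbasisP _.
set e := vbasis _ in be *.
have ev : eigenvalue (mxof e e f) z.
  apply/eigenvalueP; exists (rVof e v).
    by rewrite -rVof_app // fv linearZ.
  by rewrite rVof_eq0.
rewrite /cspectrum /= eigenvalue_map => /(_ ev).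
by rewrite expr0n /= addr0 sqrtr_sqr; exact: le_trans (ler_norm z).
Qed.

Lemma symposdef_eigvals_gt0 d (H : 'M[R]_d) x :
  symposdef H -> x \in eigvals H -> 0 < x.
Proof.
move=> [Hsym Hpos] xH; have [_ cpE] := eigvalsP Hsym.
have : eigenvalue H x by rewrite eigenvalue_root_char cpE root_prod_XsubC.
move=> /eigenvalueP[v vH v0].
have v0T : v^T != 0 by rewrite trmx_eq0.
have := Hpos _ v0T; rewrite trmxK vH -scalemxAl mxE.
have vv : 0 <= (v *m v^T) 0 0.
  by rewrite mxE sumr_ge0 // => i _; rewrite mxE -expr2 sqr_ge0.
move=> xv; rewrite ltNge; apply/negP => x0.
by have := mulr_le0_ge0 x0 vv; rewrite leNgt xv.
Qed.

Lemma mxtrace_eigvals d (H : 'M[R]_d) : (0 < d)%N -> H^T = H ->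
  \tr H = \sum_(i < d) (eigvals H)`_i.
Proof.
move=> d0 Hsym; have [_ cpE] := eigvalsP Hsym; have := size_eigvals Hsym.
have := char_poly_trace H d0; rewrite cpE; move: (eigvals H) => s + sE.
rewrite -{1}sE coefPn_prod_XsubC ?sE -?lt0n // => /oppr_inj <-.
by rewrite (big_nth 0) big_mkord sE.
Qed.

End RealEigenvalues.

(** * Eigenvectors of the covariance operator from secular roots *)

Section HeavyBallEigenvalues.
Variables (R : realType) (d : nat) (H : 'M[R]_d) (eta beta : R) (B : nat).

Let l (i : 'I_d) : R := (eigvals H)`_i.

(** The trace of the 2 x 2 block of [hb_matrix] at [l i]; the determinant of that block is
    [beta]. *)
Definition hb_trace i : R := 1 + beta - eta * (1 - beta) * l i.

(** One factor [l i] comes from the trace against [Lambda], the other from the matrix [Lambda] that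
    it multiplies. *)
Definition hb_weight i : R := (eta * (1 - beta)) ^+ 2 / B%:R * l i ^+ 2.

Lemma hb_secular_le_rate z : (0 < d)%N -> (forall i, 0 < l i) ->
  0 <= beta -> beta < z -> (forall i, 0 < hb_den beta (hb_trace i) z) ->
  hb_secular hb_weight hb_trace beta z = 1 -> z <= hb_rate H eta beta B.
Proof.
move=> d0 l0 b0 bz D0 F1.
have z0 : 0 < z by apply: le_lt_trans bz.
(* These blocks solve [z S - A S A^T = diag(Lambda, 0)] with [A] the heavy-ball matrix: its lower
   blocks force [z r = p] and [(z + beta) q = t p]. *)
pose p : 'rV[R]_d := \row_i (l i * hb_resolvent beta (hb_trace i) z).
pose q : 'rV[R]_d := \row_i (hb_trace i / (z + beta) * p 0 i).
pose r : 'rV[R]_d := \row_i (p 0 i / z).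
pose S := block_mx (diag_mx p) (diag_mx q) (diag_mx q) (diag_mx r).
have Ssym : S \in symspace R (d + d).
  by rewrite mem_symspace tr_block_mx !tr_diag_mx.
apply: (@eigenvalue_le_spectral_radius _ _ _ (vsproj _ S)).
  apply/eqP => /(congr1 vsval); rewrite vsprojK // linear0 => S0.
  have := congr1 (fun M : 'M_(d + d) => ulsubmx M (Ordinal d0) (Ordinal d0)) S0.
  rewrite /S block_mxKul !mxE eqxx mulr1n => /eqP.
  by rewrite gt_eqF // mulr_gt0 ?hb_resolvent_gt0.
apply: (can_inj (@vsvalK _ _ _)); rewrite hb_opE linearZ /= vsprojK //.
(* The secular equation normalizes the coefficient of the rank-one term to 1, so [S] is an
   eigenvector. *)
have trE :
    eta ^+ 2 * (1 - beta) ^+ 2 * (B%:R^-1 * \tr (Lambda H *m diag_mx p)) = 1.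
  rewrite mulmx_diag mxtrace_diag -[RHS]F1 /hb_secular !mulr_sumr.
  by apply: eq_bigr => i _; rewrite !mxE /hb_weight /l; ring.
have AE : hb_matrix H eta beta = block_mx (diag_mx (\row_i hb_trace i))
    (diag_mx (const_mx (- beta))) (diag_mx (const_mx 1)) 0.
  rewrite /hb_matrix !diag_const_mx raddfN; congr block_mx.
  apply/matrixP => i j; rewrite !mxE /hb_trace /l.
  by case: eqVneq => [->|_]; rewrite ?mulr1n ?mulr0n; ring.
rewrite /hb_cov /S block_mxKul !scale_block_mx scalerA trE scale1r !scaler0.
rewrite AE tr_block_mx !tr_diag_mx trmx0 !mulmx_block !mulmx_diag.
rewrite !mul0mx !mulmx0 !addr0 !mulmxDl !mulmx_diag add_block_mx !addr0.
congr block_mx; apply/matrixP => i j; rewrite !mxE;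
  case: eqVneq => [->|_]; rewrite ?mulr1n ?mulr0n //; try by ring.
all: have := D0 j; rewrite /hb_resolvent /hb_den /l => Dj.
all: field; rewrite ?subr_eq0 ?gt_eqF //; lra.
Qed.

End HeavyBallEigenvalues.

(** * Scalar inequalities at [z = r ^+ 2] *)

Section HeavyBallBounds.
Variable R : rcfType.
Implicit Types b c r a : R.

(** At a square, [hb_den] is a difference of squares whose two factors have a positive sum. *)
Lemma hb_den_sqr_gt0 b t r : 0 <= b -> 0 < r -> 0 < hb_den b t (r ^+ 2) ->
  r * t < r ^+ 2 + b /\ - (r * t) < r ^+ 2 + b.
Proof. by move=> b0 r0; rewrite /hb_den => D0; split; nra. Qed.

(** Positivity at [l0] bounds [a] from below and at [l1] from above; eliminating [a] bounds
    [l0 / l1] from below. *)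
Lemma hb_den_gt0_condition_number b r a l0 l1 :
  0 <= b -> 0 < r -> r < 1 -> b < r ^+ 2 -> 0 < a -> 0 < l0 -> 0 < l1 ->
  0 < hb_den b (1 + b - a * l0) (r ^+ 2) ->
  0 < hb_den b (1 + b - a * l1) (r ^+ 2) ->
  1 - r ^+ 2 < 4 * Num.sqrt (l0 / l1).
Proof.
move=> b0 r0 r1 br a0 l0p l1p /(hb_den_sqr_gt0 b0 r0)[D0 _].
move=> /(hb_den_sqr_gt0 b0 r0)[_ D1].
have s0 : 0 <= Num.sqrt (l0 / l1) := sqrtr_ge0 _.
have sE : l0 = Num.sqrt (l0 / l1) ^+ 2 * l1.
  by rewrite sqr_sqrtr ?divfK ?gt_eqF // ltW // divr_gt0.
move: (Num.sqrt _) s0 sE => s s0 sE.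
have low : (1 - r) * (r - b) < r * (a * l0) by lra.
have high : r * (a * l1) < (1 + r) * (r + b) by lra.
have mid : (1 - r) * (r - b) < s ^+ 2 * ((1 + r) * (r + b)).
  apply: lt_le_trans low _; rewrite sE.
  rewrite (_ : r * _ = s ^+ 2 * (r * (a * l1))); last by ring.
  by apply: ler_wpM2l; rewrite ?sqr_ge0 ?ltW.
(* This is [b <= r ^+ 2] rearranged; it removes [b] from [mid]. *)
have rb : (1 - r) * (r + b) <= (1 + r) * (r - b) by lra.
have sq : (1 - r) ^+ 2 < (s * (1 + r)) ^+ 2.
  have rb0 : 0 < r + b by lra.
  rewrite -(ltr_pM2r rb0).
  apply: le_lt_trans (_ : (1 - r) * (1 + r) * (r - b) < _).
    by rewrite expr2 -!mulrA; apply: ler_wpM2l => //; lra.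
  rewrite (_ : _ * _ * (r + b) = (1 + r) * (s ^+ 2 * ((1 + r) * (r + b))));
    last by ring.
  rewrite (_ : _ * _ * (r - b) = (1 + r) * ((1 - r) * (r - b)));
    last by ring.
  by rewrite ltr_pM2l //; lra.
have sr : 1 - r < s * (1 + r).
  have sr0 : 0 <= s * (1 + r) by apply: mulr_ge0; lra.
  by move: sq; rewrite ltr_sqr ?nnegrE // subr_ge0 ltW.
(* Multiply [sr] by [1 + r < 2]. *)
nra.
Qed.

(** Each summand is bounded below by a multiple of [l i], so the sum of the [l i] appears; the
    denominator at [i0] then bounds [a] from below. *)
Lemma hb_secular_ge1 (I : finType) (l : I -> R) b r a B i0 :
  0 <= b -> 0 < r -> r < 1 -> b < r ^+ 2 -> 0 < a -> 0 < B ->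
  (forall i, 0 < l i) ->
  (forall i, 0 < hb_den b (1 + b - a * l i) (r ^+ 2)) ->
  4 * (B * l i0) <= (\sum_i l i) * (1 - r ^+ 2) ->
  1 <= hb_secular (fun i => a ^+ 2 / B * l i ^+ 2)
         (fun i => 1 + b - a * l i) b (r ^+ 2).
Proof.
move=> b0 r0 r1 br a0 B0 l0 D0 trB.
have r2 : 0 < r ^+ 2 by rewrite exprn_gt0.
have rr : r ^+ 2 < r by nra.
(* [a / B * K * l i] is the i-th term with [hb_den] replaced by its upper bound [DE]. *)
pose K := r * (r ^+ 2 + b) / ((r ^+ 2 - b) * (1 + r) * (r + b)).
have den0 : 0 < (r ^+ 2 - b) * (1 + r) * (r + b).
  by apply: mulr_gt0; [apply: mulr_gt0|]; lra.
apply: le_trans (_ : \sum_i a / B * K * l i <= _); last first.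
  apply: ler_sum => i _.
  have Di := D0 i; have li := l0 i.
  have [_ D1] := hb_den_sqr_gt0 b0 r0 Di.
  have DE : hb_den b (1 + b - a * l i) (r ^+ 2) <=
      r * (a * l i) * ((1 + r) * (r + b)).
    have -> : hb_den b (1 + b - a * l i) (r ^+ 2) =
        (r * (a * l i) - (1 - r) * (r - b)) *
        ((1 + r) * (r + b) - r * (a * l i)).
      by rewrite /hb_den; ring.
    have al : 0 < r * (a * l i) by rewrite !mulr_gt0.
    have : 0 <= (1 - r) * (r - b) by apply: mulr_ge0; lra.
    have : 0 <= (1 + r) * (r + b) - r * (a * l i) by lra.
    move: (r * (a * l i)) ((1 + r) * (r + b)) ((1 - r) * (r - b)) al.
    by move=> x y w x0 yx w0; nra.
  rewrite /hb_resolvent.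
  move: (hb_den _ _ _) Di DE => D Di DE.
  rewrite mulrA ler_pdivlMr; last by apply: mulr_gt0 => //; lra.
  rewrite (_ : _ * l i * _ =
      a / B * l i * (r * (r ^+ 2 + b)) / ((1 + r) * (r + b)) * D);
    last by rewrite /K; field; rewrite !gt_eqF //; lra.
  rewrite -ler_pdivlMl; last first.
    by apply: divr_gt0; rewrite !mulr_gt0 ?invr_gt0 //; lra.
  apply: le_trans DE _; rewrite le_eqVlt; apply/orP; left; apply/eqP.
  by field; rewrite !gt_eqF //; lra.
rewrite -mulr_sumr.
move: (\sum_i l i) trB => T trB.
have Di := D0 i0; have [D1 _] := hb_den_sqr_gt0 b0 r0 Di.
have li := l0 i0; move: (l i0) li trB D1 {Di} => m m0 trB D1.
have T0 : 0 < T.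
  have c1 : 0 < 1 - r ^+ 2 by lra.
  rewrite -(pmulr_lgt0 _ c1); apply: lt_le_trans trB.
  by rewrite !mulr_gt0.
have low : (1 - r) * (r - b) <= r * (a * m) by lra.
rewrite (_ : _ * T = a * T * r * (r ^+ 2 + b) /
   (B * ((r ^+ 2 - b) * (1 + r) * (r + b)))); last first.
  by rewrite /K; field; rewrite !gt_eqF //; lra.
rewrite ler_pdivlMr; last by apply: mulr_gt0.
rewrite mul1r.
pose W := (r ^+ 2 - b) * (r + b).
have W0 : 0 <= W by apply: mulr_ge0; lra.
have m1 : 0 < m * (1 + r) by apply: mulr_gt0; lra.
rewrite -(ler_pM2r m1).
apply: le_trans (_ : T * (1 - r ^+ 2) * W <= _).
  (* The 4 in [trB] absorbs [(1 + r) ^+ 2]. *)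
  apply: le_trans (_ : 4 * (B * m) * W <= _); last exact: ler_wpM2r.
  rewrite (_ : B * _ * _ = (1 + r) ^+ 2 * (B * m * W));
    last by rewrite /W; ring.
  rewrite -[4 * _ * _]mulrA; apply: ler_wpM2r.
    by rewrite mulr_ge0 // mulr_ge0 // ltW.
  by nra.
have W1 : W <= (r - b) * (r ^+ 2 + b).
  rewrite /W -subr_ge0 (_ : _ - _ = 2 * b * (r - r ^+ 2)); last by ring.
  by rewrite !mulr_ge0 //; lra.
have T1 : 0 <= T * (1 - r ^+ 2) by apply: mulr_ge0; lra.
apply: le_trans (ler_wpM2l T1 W1) _.
rewrite (_ : T * _ * _ = T * (1 + r) * (r ^+ 2 + b) * ((1 - r) * (r - b)));
  last by ring.
rewrite (_ : _ * (m * _) = T * (1 + r) * (r ^+ 2 + b) * (r * (a * m)));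
  last by ring.
by apply: ler_wpM2l => //; rewrite !mulr_ge0 //; lra.
Qed.

End HeavyBallBounds.

(** * The lower bound on the rate and its infimum *)

Lemma hb_rate_ge0 (R : realType) d (H : 'M[R]_d) eta beta B :
  (0 < d)%N -> 0 <= hb_rate H eta beta B.
Proof.
move=> d0; apply: spectral_radius_ge0; rewrite lt0n dimv_eq0.
apply/negP => /eqP V0.
have := memvf (vsproj (symspace R (d + d)) 1%:M).
rewrite V0 memv0 => /eqP /(congr1 vsval).
rewrite vsprojK ?mem_symspace ?trmx1 // linear0 => /matrixP.
move=> /(_ (lshift d (Ordinal d0)) (lshift d (Ordinal d0))).
by rewrite !mxE eqxx => /eqP; rewrite oner_eq0.
Qed.

Lemma hb_rate_lower_bound (R : realType) d (H : 'M[R]_d) eta beta B :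
  (0 < d)%N -> symposdef H -> (0 < B)%N ->
  0 < eta -> 0 <= beta -> beta < 1 ->
  1 - 8 * Num.min (B%:R * lambda_min H / \tr H)
                  (Num.sqrt (lambda_min H / lambda_max H))
    <= hb_rate H eta beta B.
Proof.
move=> d0 Hpos B0 eta0 b0 b1; have Hsym := Hpos.1.
have sE := size_eigvals Hsym.
pose l (i : 'I_d) : R := (eigvals H)`_i.
have l0 i : 0 < l i.
  by apply: (symposdef_eigvals_gt0 Hpos); rewrite mem_nth ?sE.
have dm : (d.-1 < d)%N by rewrite prednK.
have lminE : lambda_min H = l (Ordinal dm).
  by rewrite /lambda_min /l -nth_last sE.
have lmaxE : lambda_max H = l (Ordinal d0) by rewrite /lambda_max /l nth0.
rewrite lminE lmaxE (mxtrace_eigvals d0 Hsym).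
set m := Num.min _ _; set c := 1 - 8 * m.
have [c0|c0] := lerP c 0; first exact: le_trans c0 (hb_rate_ge0 _ _ _ _ d0).
pose a := eta * (1 - beta); have a0 : 0 < a by rewrite mulr_gt0 ?subr_gt0.
have BR : 0 < B%:R :> R by rewrite ltr0n.
pose t := hb_trace H eta beta.
have g0 i : 0 < hb_weight H eta beta B i.
  by apply: mulr_gt0; [apply: divr_gt0|]; rewrite ?exprn_gt0 ?l0.
have [i0 _ i0max] := @arg_maxP _ _ _ (Ordinal d0) xpredT
  (fun i => hb_pole beta (t i)) isT.
have [cp|pc] := lerP c (hb_pole beta (t i0)).
  have [|z [pz bz Dz Fz]] :=
      hb_secular_root_above_pole b0 g0 (lt_le_trans c0 cp).
    by move=> i; exact: i0max.
  by apply: le_trans (le_trans cp pz) (hb_secular_le_rate d0 l0 b0 bz Dz Fz).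
have Dc i : 0 < hb_den beta (t i) c.
  by apply: hb_den_gt0 => //; apply: le_lt_trans pc; exact: i0max.
have bc : beta < c by apply: le_lt_trans pc; rewrite le_max lexx.
have T0 : 0 < \sum_(i < d) l i.
  rewrite (bigD1 (Ordinal d0)) //= ltr_wpDr //.
  by apply: sumr_ge0 => i _; exact: ltW.
have m0 : 0 < m.
  by rewrite lt_min sqrtr_gt0 !divr_gt0 ?mulr_gt0.
have r0 : 0 < Num.sqrt c by rewrite sqrtr_gt0.
have rE := sqr_sqrtr (ltW c0).
have r1 : Num.sqrt c < 1.
  by rewrite -sqrtr1 ltr_sqrt ?ltr01 //; rewrite /c; lra.
have br : beta < Num.sqrt c ^+ 2 by rewrite rE.
have Dr i : 0 < hb_den beta (1 + beta - a * l i) (Num.sqrt c ^+ 2).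
  by rewrite rE; exact: Dc.
have cond := hb_den_gt0_condition_number b0 r0 r1 br a0 (l0 _) (l0 _)
  (Dr (Ordinal dm)) (Dr (Ordinal d0)).
have Fc : 1 <= hb_secular (hb_weight H eta beta B) t beta c.
  have := @hb_secular_ge1 _ _ l _ _ _ _ (Ordinal dm) b0 r0 r1 br a0 BR l0 Dr.
  rewrite rE; apply.
  have -> : 1 - c = 8 * m by rewrite /c subKr.
  (* If the square root attained the minimum, [cond] would read [8 * m < 4 * m]. *)
  have mE : m = B%:R * l (Ordinal dm) / \sum_(i < d) l i.
    apply/min_idPl; rewrite leNgt; apply/negP => /ltW/min_idPr; rewrite -/m.
    by move: cond m0; rewrite rE /c => + + mE; rewrite -mE; lra.
  rewrite (_ : _ * (8 * m) = 8 * (B%:R * l (Ordinal dm))); last first.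
    by rewrite mE; field; rewrite gt_eqF.
  by have := mulr_gt0 BR (l0 (Ordinal dm)); lra.
have [z [cz Dz Fz]] := hb_secular_root b0 g0 bc Dc Fc.
exact: le_trans cz (hb_secular_le_rate d0 l0 b0 (lt_le_trans bc cz) Dz Fz).
Qed.

Theorem theorem3 (R : realType) (d : nat) (H : 'M[R]_d) (B : nat)
    (hd : (1 <= d)%N) (hH : symposdef H) (hB : (1 <= B)%N) :
  hb_opt_rate H B >=
    1 - 8 * Num.min (B%:R * lambda_min H / \tr H)
                    (Num.sqrt (lambda_min H / lambda_max H)).
Proof.
apply: lb_le_inf.
  (* A lower bound passes to [inf] only for a nonempty set; [eta = 1], [beta = 0] is admissible. *)
  by exists (hb_rate H 1 0 B), (1, 0) => //=; rewrite lexx !ltr01.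
move=> _ [[eta beta] /= [eta0 /andP[b0 b1]] <-].
exact: hb_rate_lower_bound.
Qed.
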